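(* As formal power series in $q$, $$\frac{1}{(q;q)_{\infty}}\sum_{r=1}^{\infty}q^{r^2}=\sum_{m=1}^{\infty}\sum_{l\ge 0} l\cdot R_l(m)\, q^m=\sum_{m=1}^{\infty}A_1(m)q^m.$$
   Context: $(a;b)_\infty=\prod_{n\ge 0}(1-ab^n)$. Let $\lambda=(a_1,a_2,\dots,a_k)$ be a partition of $m$, written as a nonincreasing sequence. Its Rogers--Ramanujan subpartition is the longest initial segment $(a_1,\dots,a_l)$ (possibly empty, $l=0$) such that the parts $a_1,\dots,a_l$ are pairwise distinct, no two of them are consecutive integers (i.e. $a_i-a_{i+1}\ge 2$ for $1\le i<l$), and $a_l>a_{l+1}$ (with the convention $a_{l+1}=0$ if $l=k$); $l$ is called its length. Let $R_l(m)$ be the number of partitions of $m$ whose Rogers--Ramanujan subpartition has length $l$, and $A_1(m)=\sum_{l\ge 0} l\cdot R_l(m)$. *)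

(* Defs.v *)
From HB Require Import structures.
From mathcomp Require Import all_boot all_order all_algebra finmap.
From mathcomp Require Import boolp classical_sets functions cardinality fsbigop.

Set Implicit Arguments.
Unset Strict Implicit.
Unset Printing Implicit Defensive.
Import Order.TTheory GRing.Theory Num.Theory.
Local Open Scope classical_set_scope.
Local Open Scope ring_scope.

(* A formal power series in one indeterminate is the sequence of its
   coefficients, [fps_coef f n] being the coefficient of degree [n].  It is
   wrapped in a record because [functions] already equips the type [nat -> R]
   with the pointwise product. *)
Record fps (R : Type) := Fps { fps_coef : nat -> R }.

Lemma fpsP (R : Type) (f g : fps R) :
  (forall n, fps_coef f n = fps_coef g n) -> f = g.
Proof. by case: f g => [f] [g] /= /funext ->. Qed.

HB.instance Definition _ (R : Type) := gen_eqMixin (fps R).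
HB.instance Definition _ (R : Type) := gen_choiceMixin (fps R).

Section FpsRing.
Variable R : comNzRingType.
Implicit Types f g h : fps R.

Definition fps_zero : fps R := Fps (fun=> 0).
Definition fps_add f g := Fps (fun n => fps_coef f n + fps_coef g n).
Definition fps_opp f := Fps (fun n => - fps_coef f n).
Definition fps_one : fps R := Fps (fun n => (n == 0%N)%:R).
Definition fps_mul f g :=
  Fps (fun n => \sum_(i < n.+1) fps_coef f i * fps_coef g (n - i)%N).

Fact fps_addA : associative fps_add.
Proof. by move=> f g h; apply: fpsP => n /=; rewrite addrA. Qed.
Fact fps_addC : commutative fps_add.
Proof. by move=> f g; apply: fpsP => n /=; rewrite addrC. Qed.
Fact fps_add0 : left_id fps_zero fps_add.
Proof. by move=> f; apply: fpsP => n /=; rewrite add0r. Qed.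
Fact fps_addN : left_inverse fps_zero fps_opp fps_add.
Proof. by move=> f; apply: fpsP => n /=; rewrite addNr. Qed.

HB.instance Definition _ :=
  GRing.isZmodule.Build (fps R) fps_addA fps_addC fps_add0 fps_addN.

Let trunc n f : {poly R} := \poly_(i < n.+1) fps_coef f i.

Let coef_trunc n f i : (i <= n)%N -> (trunc n f)`_i = fps_coef f i.
Proof. by move=> le_in; rewrite coef_poly ltnS le_in. Qed.

Let coef_mulE n f g i : (i <= n)%N ->
  fps_coef (fps_mul f g) i = (trunc n f * trunc n g)`_i.
Proof.
move=> le_in; rewrite coefM; apply: eq_bigr => j _.
have le_ji : (j <= i)%N by rewrite -ltnS.
by rewrite !coef_trunc ?(leq_trans _ le_in) ?leq_subr.
Qed.

Fact fps_mulC : commutative fps_mul.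
Proof.
by move=> f g; apply: fpsP => n; rewrite !(@coef_mulE n) // mulrC.
Qed.
Fact fps_mulA : associative fps_mul.
Proof.
move=> f g h; apply: fpsP => n.
have coef_mul3 a b c :
  fps_coef (fps_mul (fps_mul a b) c) n = (trunc n a * trunc n b * trunc n c)`_n.
  rewrite coefM; apply: eq_bigr => j _.
  have le_jn : (j <= n)%N by rewrite -ltnS.
  by rewrite (@coef_mulE n) // coef_trunc ?leq_subr.
by rewrite fps_mulC !coef_mul3 -[in RHS]mulrA mulrC.
Qed.
Fact fps_mul1 : left_id fps_one fps_mul.
Proof.
move=> f; apply: fpsP => n /=.
rewrite big_ord_recl /= mul1r subn0 big1 ?addr0 // => i _.
by rewrite /= mul0r.
Qed.
Fact fps_mulDl : left_distributive fps_mul fps_add.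
Proof.
move=> f g h; apply: fpsP => n /=; rewrite -big_split /=.
by apply: eq_bigr => i _; rewrite mulrDl.
Qed.
Fact fps_one_neq0 : fps_one != 0.
Proof.
apply/eqP => /(congr1 (fun f => fps_coef f 0)) /= /eqP.
by rewrite oner_eq0.
Qed.

HB.instance Definition _ := GRing.Zmodule_isComNzRing.Build (fps R)
  fps_mulA fps_mulC fps_mul1 fps_mulDl fps_one_neq0.

End FpsRing.

Section FpsUnit.
Variable R : comUnitRingType.
Implicit Types f g : fps R.

Definition fps_unit : {pred fps R} :=
  fun f => fps_coef f 0 \is a GRing.unit.

(* The first [n] coefficients of the inverse of [f]. *)
Fixpoint fps_inv_seq f n : seq R :=
  if n is n'.+1 then
    let s := fps_inv_seq f n' in
    rcons s ((fps_coef f 0)^-1 *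
             ((n' == 0%N)%:R - \sum_(i < n') s`_i * fps_coef f (n' - i)))
  else [::].

Definition fps_inv f : fps R :=
  if fps_unit f then Fps (fun n => (fps_inv_seq f n.+1)`_n) else f.

Let size_fps_inv_seq f n : size (fps_inv_seq f n) = n.
Proof. by elim: n => //= n IHn; rewrite size_rcons IHn. Qed.

Let nth_fps_inv_seq f n i : (i < n)%N ->
  (fps_inv_seq f n)`_i = (fps_inv_seq f i.+1)`_i.
Proof.
elim: n => // n IHn; rewrite ltnS leq_eqVlt => /predU1P[-> // | lt_in].
by rewrite [LHS]/= nth_rcons size_fps_inv_seq lt_in IHn.
Qed.

Fact fps_mulVf : {in fps_unit, left_inverse 1 fps_inv *%R}.
Proof.
move=> f fU; apply: fpsP => n.
have -> : fps_inv f = Fps (fun n => (fps_inv_seq f n.+1)`_n).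
  by rewrite /fps_inv (fU : fps_unit f).
rewrite [LHS]/= big_ord_recr /= subnn nth_rcons size_fps_inv_seq ltnn eqxx.
rewrite mulrAC mulVr ?mul1r //.
under eq_bigr => i _ do
  rewrite -[nth _ _ _]/((fps_inv_seq f i.+1)`_i) -(nth_fps_inv_seq f (ltn_ord i)).
by rewrite addrC subrK.
Qed.
Fact fps_unitPl f g : g * f = 1 -> fps_unit f.
Proof.
move=> /(congr1 (fun h => fps_coef h 0)) /=.
rewrite big_ord1 /= => gf1; apply/unitrP.
by exists (fps_coef g 0); split; rewrite // mulrC.
Qed.
Fact fps_inv_out : {in [predC fps_unit], fps_inv =1 id}.
Proof.
move=> f fNU; have {}fNU : ~~ fps_unit f := fNU.
by rewrite /fps_inv (negbTE fNU).
Qed.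

HB.instance Definition _ := GRing.ComNzRing_hasMulInverse.Build (fps R)
  fps_mulVf fps_unitPl fps_inv_out.

End FpsUnit.

Definition fps_q {R : comNzRingType} : fps R := Fps (fun n => (n == 1%N)%:R).

(* Convergence for the usual topology on formal power series: each coefficient
   is eventually constant. *)
Definition fps_cvg (R : Type) (u : nat -> fps R) (f : fps R) : Prop :=
  forall n, exists N, forall k, (N <= k)%N -> fps_coef (u k) n = fps_coef f n.

(* The limit of [u], and [0] if [u] diverges. *)
Definition fps_lim (R : comNzRingType) (u : nat -> fps R) : fps R :=
  xget 0 [set f | fps_cvg u f].

(* \sum_(m <= n < oo) u n *)
Definition fps_series (R : comNzRingType) (m : nat) (u : nat -> fps R) : fps R :=
  fps_lim (fun N => \sum_(m <= n < N) u n).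

(* (a; b)_oo *)
Definition qpochhammer (R : comNzRingType) (a b : fps R) : fps R :=
  fps_lim (fun N => \prod_(0 <= n < N) (1 - a * b ^+ n)).

Lemma fps_cvg_unique (R : Type) (u : nat -> fps R) (f g : fps R) :
  fps_cvg u f -> fps_cvg u g -> f = g.
Proof.
move=> uf ug; apply: fpsP => n; have [[M uM] [N uN]] := (uf n, ug n).
by rewrite -(uM (maxn M N)) ?leq_maxl // uN ?leq_maxr.
Qed.

Lemma fps_limE (R : comNzRingType) (u : nat -> fps R) (f : fps R) :
  fps_cvg u f -> fps_lim u = f.
Proof.
by move=> uf; apply: xget_unique => // g ug; apply: fps_cvg_unique ug uf.
Qed.

Lemma fps_coef_qexp (R : comNzRingType) (k n : nat) :
  fps_coef (fps_q ^+ k : fps R) n = (n == k)%:R.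
Proof.
elim: k n => [|k IHk] n; first by rewrite expr0.
rewrite exprS /=; case: n => [|n]; first by rewrite big_ord1 mul0r.
rewrite big_ord_recl mul0r add0r big_ord_recl /= mul1r subSS subn0 IHk eqSS.
by rewrite big1 ?addr0 // => i _; rewrite mul0r.
Qed.

Lemma fps_coef_mulqexp (R : comNzRingType) (f : fps R) (k n : nat) :
  fps_coef (f * fps_q ^+ k) n = if (k <= n)%N then fps_coef f (n - k) else 0.
Proof.
rewrite mulrC /=; under eq_bigr => i _ do rewrite fps_coef_qexp.
case: ifPn => [le_kn | nle_kn].
  rewrite (bigD1 (Ordinal (le_kn : k < n.+1)%N)) //= eqxx mul1r big1 ?addr0 //.
  by move=> i /negbTE; rewrite -val_eqE /= => ->; rewrite mul0r.
rewrite big1 // => i _; case: eqP => [ik|_]; last by rewrite mul0r.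
by rewrite -ik -ltnS ltn_ord in nle_kn.
Qed.

Lemma qpochhammer_cvg (R : comNzRingType) :
  fps_cvg (fun N => \prod_(0 <= n < N) (1 - fps_q * fps_q ^+ n))
          (qpochhammer fps_q fps_q : fps R).
Proof.
set u : nat -> fps R := fun N => _.
have uS N n : (n <= N)%N -> fps_coef (u N.+1) n = fps_coef (u N) n.
  move=> le_nN.
  have -> : u N.+1 = u N - u N * fps_q ^+ N.+1.
    by rewrite /u big_nat_recr //= -exprS mulrBr mulr1.
  rewrite -[LHS]/(fps_coef (u N) n - fps_coef (u N * fps_q ^+ N.+1) n).
  by rewrite fps_coef_mulqexp ltnNge le_nN subr0.
have u_cvg : fps_cvg u (Fps (fun n => fps_coef (u n) n)).
  move=> n; exists n => k /subnKC <-; elim: (k - n)%N => [|d IHd] /=.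
    by rewrite addn0.
  by rewrite addnS uS ?leq_addr // IHd.
by rewrite /qpochhammer -/u (fps_limE u_cvg).
Qed.

Lemma qpochhammer_unit (R : comUnitRingType) :
  (qpochhammer fps_q fps_q : fps R) \is a GRing.unit.
Proof.
rewrite unfold_in /= /fps_unit; have [N /(_ N (leqnn N)) <-] := @qpochhammer_cvg R 0.
elim: N => [|N IHN]; first by rewrite big_geq // unitr1.
rewrite big_nat_recr //= big_ord1 unitrMl //= subn0.
by rewrite big_ord1 /= mul0r oppr0 addr0 unitr1.
Qed.

Lemma fps_series_cvg (R : comNzRingType) (m : nat) (v : nat -> fps R) :
  (forall k n, (n < k)%N -> fps_coef (v k) n = 0) ->
  fps_cvg (fun N => \sum_(m <= k < N) v k) (fps_series m v).
Proof.
move=> v0; set u : nat -> fps R := fun N => _.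
have uS N n : (n < N)%N -> fps_coef (u N.+1) n = fps_coef (u N) n.
  move=> lt_nN; rewrite /u; have [le_mN | lt_Nm] := leqP m N; last first.
    by rewrite !big_geq // ltnW.
  by rewrite big_nat_recr //= v0 // addr0.
have u_cvg : fps_cvg u (Fps (fun n => fps_coef (u n.+1) n)).
  move=> n; exists n.+1 => k /subnKC <-; elim: (k - n.+1)%N => [|d IHd] /=.
    by rewrite addn0.
  by rewrite addnS uS ?leq_addr // IHd.
by rewrite /fps_series -/u (fps_limE u_cvg).
Qed.

Definition is_partition (m : nat) (s : seq nat) : bool :=
  [&& sorted geq s, 0%N \notin s & sumn s == m].

(* The conditions on the initial segment of length [l] of [s] = (a_1, ..., a_k):
   a_i - a_(i+1) >= 2 for 1 <= i < l, which for nonincreasing parts says that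
   they are distinct and that no two are consecutive, and a_l > a_(l+1), with
   a_(k+1) = 0 given by the default value of [nth].  The parts are indexed
   from 0, so that a_l is [nth 0 s l.-1]. *)
Definition rr_segment (s : seq nat) (l : nat) : bool :=
  [&& (l <= size s)%N,
      sorted (fun a b => (b + 2 <= a)%N) (take l s) &
      (0 < l)%N ==> (nth 0 s l < nth 0 s l.-1)%N].

Definition rr_length (s : seq nat) : nat :=
  \max_(l < (size s).+1 | rr_segment s l) l.

Definition rr_partitions (l m : nat) : set (seq nat) :=
  [set s | is_partition m s /\ rr_length s = l].

Lemma finite_rr_partitions (l m : nat) : finite_set (rr_partitions l m).
Proof.
apply: (@sub_finite_set _ _
  [set map val (bs : seq 'I_m.+1) | bs in [set: {bseq m of 'I_m.+1}]]).
  move=> s [/and3P[_ s_gt0 /eqP sum_s] _].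
  have le_sm x : x \in s -> (x < m.+1)%N.
    move=> xs; rewrite ltnS -sum_s.
    by rewrite sumnE (big_rem x) //= leq_addr.
  have sz_s : (size (map (@inord m) s) <= m)%N.
    rewrite size_map -sum_s sumnE -sum1_size !big_seq.
    apply: leq_sum => x xs; rewrite lt0n.
    by apply: contraNneq s_gt0 => <-.
  exists (Bseq sz_s) => //=; rewrite -map_comp -[RHS]map_id.
  by apply/eq_in_map => x /le_sm lt_xm /=; rewrite inordK.
exact/finite_image/finite_finset.
Qed.

Definition rr_count (l m : nat) : nat := #|` fset_set (rr_partitions l m)|.

(* A sum over the infinite set [[set: nat]] with finite support: [rr_count l m]
   vanishes as soon as [m < l]. *)
Definition rr_A1 (m : nat) : nat := \sum_(l \in [set: nat]) (l * rr_count l m)%N.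

Lemma rr_count_eq0 (l m : nat) : (m < l)%N -> rr_count l m = 0%N.
Proof.
move=> lt_ml; rewrite /rr_count.
suff -> : rr_partitions l m = set0 by rewrite fset_set0 cardfs0.
apply/seteqP; split=> // s [/and3P[_ s_gt0 /eqP sum_s] len_s] /=.
have sz_s : (size s <= m)%N.
  rewrite -sum_s sumnE -sum1_size !big_seq.
  apply: leq_sum => x xs; rewrite lt0n.
  by apply: contraNneq s_gt0 => <-.
have : (rr_length s <= size s)%N by apply/bigmax_leqP => i _; rewrite -ltnS.
by rewrite len_s leqNgt (leq_ltn_trans sz_s lt_ml).
Qed.

(* Main.v *)
(* The double count [\sum_l l * R_l(m) = \sum_(r >= 1) #{s : rr_length s >= r}]
   reduces the theorem to the fact that the partitions of [m] whose
   Rogers--Ramanujan subpartition has length at least [r] are in bijection with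
   the partitions of [m - r ^ 2]: add the staircase 2r-1, 2r-3, ..., 3, 1, of
   sum [r ^ 2], to the first [r] parts, after padding with zeros. *)
Require Import Defs.
From HB Require Import structures.
From mathcomp Require Import all_boot all_order all_algebra finmap.
From mathcomp Require Import boolp classical_sets functions cardinality fsbigop.
From mathcomp Require Import zify.
Import Order.TTheory GRing.Theory Num.Theory.
Local Open Scope classical_set_scope.
Local Open Scope ring_scope.

(** * Partitions and admissible segments, by recursion on the list *)

Lemma is_partition_cons (a m : nat) (s : seq nat) :
  is_partition m (a :: s) =
    [&& (0 < a)%N, (head 0%N s <= a)%N, (a <= m)%N & is_partition (m - a) s].
Proof.
rewrite /is_partition inE negb_or [0%N == a]eq_sym -lt0n /=.
have -> : path geq a s = (head 0%N s <= a)%N && sorted geq s by case: s.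
have -> : (a + sumn s == m)%N = (a <= m)%N && (sumn s == m - a)%N by lia.
by case: (0 < a)%N; case: (head _ _ <= _)%N; case: (a <= m)%N; rewrite ?andbF.
Qed.

Lemma is_partition_nil (m : nat) : is_partition m [::] = (m == 0%N).
Proof. by rewrite /is_partition /= eq_sym. Qed.

Lemma rr_segment_nil (r : nat) : rr_segment [::] r = (r == 0%N).
Proof. by case: r. Qed.

Lemma rr_segment0 (s : seq nat) : rr_segment s 0.
Proof. by rewrite /rr_segment take0. Qed.

(** The boolean [0 < r] counts as 0 or 1: a strict drop suffices after the last part of the segment,
    while a gap of at least 2 is required between two of its parts. *)
Lemma rr_segment_cons (a r : nat) (s : seq nat) :
  rr_segment (a :: s) r.+1 = (head 0%N s + (0 < r) < a)%N && rr_segment s r.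
Proof.
case: r => [|r].
  by rewrite rr_segment0 andbT addn0 /rr_segment /= take0 /= nth0.
case: s => [|b s]; first by rewrite rr_segment_nil andbF.
rewrite /rr_segment /= addn1 addn2 !ltnS.
by rewrite -!andbA; case: (r <= _)%N; rewrite ?andbF.
Qed.

(** A gap of 2 is in particular a strict drop, so a shortened segment still satisfies the end
    condition: admissible lengths are closed downwards. *)
Lemma rr_segmentS (s : seq nat) (r : nat) : rr_segment s r.+1 -> rr_segment s r.
Proof.
elim: s r => [|a s IHs] [|r]; rewrite ?rr_segment_nil ?rr_segment0 //.
rewrite !rr_segment_cons => /andP[lt_sa /IHs ->]; rewrite andbT.
by apply: leq_ltn_trans lt_sa; rewrite leq_add2l; case: r.
Qed.

Lemma leq_rr_length (s : seq nat) (r : nat) :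
  (r <= rr_length s)%N = rr_segment s r.
Proof.
apply/idP/idP => [le_r | seg_r].
  have seg_len : rr_segment s (rr_length s).
    rewrite /rr_length; have [|i seg_i ->] := @eq_bigmax_cond
      _ [pred l : 'I_(size s).+1 | rr_segment s l] (fun l => l : nat).
      by apply/card_gt0P; exists ord0; rewrite inE /= rr_segment0.
    exact: seg_i.
  (* Descent from the maximum, one unit at a time; past [rr_length s] the truncated difference is 0,
     which is always admissible. *)
  rewrite -(subKn le_r); elim: (_ - r)%N => [|d IHd]; first by rewrite subn0.
  have [lt_d | ge_d] := ltnP d (rr_length s).
    by apply: rr_segmentS; rewrite -subSn // subSS.
  by rewrite (eqP (_ : _ - d.+1 == 0)%N) ?rr_segment0 // subn_eq0 ltnW.
have lt_r : (r < (size s).+1)%N by case/and3P: seg_r.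
exact: (leq_bigmax_cond (Ordinal lt_r)).
Qed.

(** * The staircase bijection *)

Fixpoint add_staircase (r : nat) (s : seq nat) : seq nat :=
  if r is r'.+1 then (head 0 s + r'.*2.+1)%N :: add_staircase r' (behead s)
  else s.

(** At [r = 0] the truncated predecessor gives 0, so one formula also covers the empty staircase. *)
Lemma head_add_staircase (r : nat) (s : seq nat) :
  head 0%N (add_staircase r s) = (head 0%N s + r.*2.-1)%N.
Proof. by case: r => //=; rewrite addn0. Qed.

Lemma is_partition_behead (m : nat) (s : seq nat) :
  is_partition m s ->
  is_partition (m - head 0%N s) (behead s) /\ (head 0%N s <= m)%N.
Proof.
by case: s => [|a s]; rewrite ?subn0 // is_partition_cons => /and4P[].
Qed.

Lemma is_partition_behead_le (m : nat) (s : seq nat) :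
  is_partition m s -> (head 0%N (behead s) <= head 0%N s)%N.
Proof. by case: s => //= a s; rewrite is_partition_cons => /and4P[]. Qed.

(** Consecutive steps differ by 2, which turns a weak decrease into a gap of at least 2; the last
    step, 1, turns it into a strict drop. *)
Lemma add_staircase_partition (r m : nat) (s : seq nat) :
  is_partition m s ->
  is_partition (m + r ^ 2) (add_staircase r s) /\
  rr_segment (add_staircase r s) r.
Proof.
elim: r m s => [|r IHr] m s part_s; first by rewrite addn0 rr_segment0.
have [/IHr[part_t seg_t] le_sm] := is_partition_behead _ _ part_s.
have le_s := is_partition_behead_le _ _ part_s.
rewrite /= is_partition_cons rr_segment_cons seg_t head_add_staircase.
have -> : (m + r.+1 ^ 2 - (head 0 s + r.*2.+1) = m - head 0 s + r ^ 2)%N by nia.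
by rewrite part_t; split; apply/and4P || apply/andP; split => //; nia.
Qed.

(** For positive [r], padding gives [[::]] and [[:: 0]] the same image; positivity of the parts
    rules out such a collision. *)
Lemma add_staircase_inj (r m n : nat) (s t : seq nat) :
  is_partition m s -> is_partition n t ->
  add_staircase r s = add_staircase r t -> s = t.
Proof.
elim: r m n s t => // r IHr m n s t part_s part_t [/addIn eq_head].
have [bs _] := is_partition_behead _ _ part_s.
have [bt _] := is_partition_behead _ _ part_t.
move=> /(IHr _ _ _ _ bs bt); move: part_s part_t eq_head.
case: s {bs} => [|a s]; case: t {bt} => [|b t] //=; last by move=> _ _ -> ->.
  by rewrite !is_partition_cons => _ /andP[+ _] eq0; rewrite -eq0.
by rewrite !is_partition_cons => /andP[+ _] _ eq0; rewrite eq0.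
Qed.

Lemma add_staircase_surj (r m : nat) (s : seq nat) :
  is_partition m s -> rr_segment s r ->
  (r ^ 2 <= m)%N /\
  exists2 t, is_partition (m - r ^ 2) t & add_staircase r t = s.
Proof.
elim: r m s => [|r IHr] m s part_s; first by split=> //; exists s; rewrite ?subn0.
case: s part_s => [|a s]; first by rewrite rr_segment_nil.
rewrite is_partition_cons rr_segment_cons.
move=> /and4P[a_gt0 _ le_am part_s] /andP[lt_sa seg_s].
have [le_rm [t part_t def_s]] := IHr _ _ part_s seg_s.
rewrite -def_s head_add_staircase in lt_sa.
have le_ra : (r.*2.+1 <= a)%N by lia.
split; first by nia.
have eq_m : (m - r.+1 ^ 2 - (a - r.*2.+1) = m - a - r ^ 2)%N by nia.
(* If [a] is exactly its step, the gap condition leaves [t] a head of 0, so [t] is empty and the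
   preimage is [[::]] rather than a list of zeros. *)
case: (posnP (a - r.*2.+1)) => [a0 | a_r].
  have t0 : t = [::].
    case: t part_t lt_sa {def_s} => // b t.
    by rewrite is_partition_cons => /= /andP[]; lia.
  exists [::]; last by rewrite -def_s t0 /=; congr (_ :: _); lia.
  by rewrite t0 !is_partition_nil in part_t *; nia.
exists ((a - r.*2.+1)%N :: t); last by rewrite /= def_s subnK.
rewrite is_partition_cons a_r eq_m part_t andbT /=; apply/andP; split; nia.
Qed.

(** * Partitions with bounded parts *)

Definition bounded_partitions (k n : nat) : set (seq nat) :=
  [set s | is_partition n s && (head 0%N s <= k)%N].

(** The head is the largest part, so this is the coefficient of [q^n] in [1/((1-q)...(1-q^k))]; the
    bound [k] matches the partial products of [(q;q)_oo]. *)
Definition num_partitions (k n : nat) : nat :=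
  #|` fset_set (bounded_partitions k n)|.

(** Removing the staircase shows that a segment of length [r] forces [r ^ 2 <= m]. *)
Lemma rr_length_leq (m : nat) (s : seq nat) :
  is_partition m s -> (rr_length s <= m)%N.
Proof.
move=> part_s; have := leqnn (rr_length s); rewrite leq_rr_length => seg_s.
by have [] := add_staircase_surj _ _ _ part_s seg_s; nia.
Qed.

Lemma finite_partitions (m : nat) : finite_set [set s | is_partition m s].
Proof.
apply: (@sub_finite_set _ _ (\bigcup_(l in `I_m.+1) rr_partitions l m)).
  by move=> s part_s; exists (rr_length s) => //=; rewrite ltnS rr_length_leq.
by apply: bigcup_finite => [|l _]; [exact: finite_II | exact: finite_rr_partitions].
Qed.

Lemma finite_bounded_partitions (k n : nat) : finite_set (bounded_partitions k n).
Proof.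
by apply: sub_finite_set (finite_partitions n) => s /andP[].
Qed.

Lemma card_fset_set_image (T U : choiceType) (f : T -> U) (A : set T) :
  finite_set A -> {in A &, injective f} ->
  #|` fset_set (f @` A)| = #|` fset_set A|.
Proof.
move=> finA injf; rewrite fset_set_image // card_in_imfset //= => x y.
by rewrite !in_fset_set //; exact: injf.
Qed.

Lemma num_partitions0 (n : nat) : num_partitions 0 n = (n == 0%N).
Proof.
have -> : num_partitions 0 n = #|` fset_set [set s : seq nat | s = [::] /\ n = 0%N]|.
  congr #|` fset_set _|; apply/seteqP; split=> s /=; last first.
    by case=> -> ->.
  case: s => [|a s] /andP[]; first by rewrite is_partition_nil => /eqP.
  by rewrite is_partition_cons /= leqn0 => /and4P[+ _ _ _] /eqP a0; rewrite a0.
case: eqP => [-> | n0].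
  suff -> : [set s : seq nat | s = [::] /\ 0%N = 0%N] = [set [::]].
    by rewrite fset_set1 cardfs1.
  by apply/seteqP; split=> s /= => [[]|].
suff -> : [set s : seq nat | s = [::] /\ n = 0%N] = set0.
  by rewrite fset_set0 cardfs0.
by apply/seteqP; split=> s // [].
Qed.

(** A partition with parts at most [k.+1] either has no part [k.+1] or begins with one; deleting
    that one keeps the bound. *)
Lemma num_partitionsS (k n : nat) :
  num_partitions k.+1 n = (num_partitions k n +
    if (k < n)%N then num_partitions k.+1 (n - k.+1) else 0)%N.
Proof.
rewrite /num_partitions; case: ifPn => [lt_kn | le_nk]; last first.
  rewrite addn0; congr #|` fset_set _|; apply/seteqP; split=> -[|a s] //= /andP[].
    rewrite /bounded_partitions /= => part_s le_ak; rewrite part_s /=.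
    by move: part_s; rewrite is_partition_cons => /and4P[]; lia.
  by rewrite /bounded_partitions /= => -> /leqW.
have finS := finite_bounded_partitions.
have <- : #|` fset_set (cons k.+1 @` bounded_partitions k.+1 (n - k.+1))| =
          #|` fset_set (bounded_partitions k.+1 (n - k.+1))|.
  by apply: card_fset_set_image => // s t _ _ [].
have -> : bounded_partitions k.+1 n =
  bounded_partitions k n `|` cons k.+1 @` bounded_partitions k.+1 (n - k.+1).
  apply/seteqP; split=> [[|a s]|s]; rewrite /bounded_partitions /=.
  - by left.
  - move=> /andP[part_s]; rewrite leq_eqVlt ltnS => /predU1P[eq_a|le_a]; last first.
      by left; apply/andP.
    right; exists s; last by rewrite eq_a.
    by move: part_s; rewrite is_partition_cons eq_a => /and4P[_ -> _ ->].
  - case=> [/andP[-> /leqW] // | [t /andP[part_t le_t] <-]].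
    by rewrite is_partition_cons /= part_t le_t lt_kn leqnn.
rewrite fset_setU //; last exact: finite_image.
rewrite cardfsU -fset_setI //; last exact: finite_image.
rewrite (_ : _ `&` _ = set0) ?fset_set0 ?cardfs0 ?subn0 //.
apply/seteqP; split=> s //= [] /andP[_ le_s] [t _ def_s].
by rewrite -def_s /= ltnn in le_s.
Qed.

Lemma num_partitions_stable (k n : nat) :
  (n <= k)%N -> num_partitions k n = num_partitions n n.
Proof.
move=> /subnKC <-; elim: (k - n)%N => [|d IHd]; first by rewrite addn0.
by rewrite addnS num_partitionsS ltnNge leq_addr addn0.
Qed.

(** * The double count *)

Lemma card_rr_segment (m r : nat) :
  #|` fset_set [set s | is_partition m s && rr_segment s r]| =
  if (r ^ 2 <= m)%N then num_partitions (m - r ^ 2) (m - r ^ 2) else 0%N.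
Proof.
case: ifPn => [le_rm | nle_rm]; last first.
  rewrite (_ : mkset _ = set0) ?fset_set0 ?cardfs0 //.
  apply/seteqP; split=> s // /andP[part_s seg_s].
  by have [] := add_staircase_surj _ _ _ part_s seg_s; rewrite (negbTE nle_rm).
set n := (m - r ^ 2)%N.
rewrite /num_partitions -(@card_fset_set_image _ _ (add_staircase r) (bounded_partitions n n)).
- congr #|` fset_set _|; apply/seteqP; split=> s.
    move=> /andP[part_s seg_s].
    have [_ [t part_t def_s]] := add_staircase_surj _ _ _ part_s seg_s.
    exists t => //; apply/andP; split=> //.
    by have [] := is_partition_behead _ _ part_t.
  case=> t /andP[part_t _] <-.
  have [] := add_staircase_partition r _ _ part_t.
  by rewrite subnK //= => -> ->.
- exact: finite_bounded_partitions.
- move=> s t; rewrite !inE => /andP[part_s _] /andP[part_t _].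
  exact: add_staircase_inj part_s part_t.
Qed.

Lemma card_fset_set_sum (T : choiceType) (A : set T) (p : pred T) :
  finite_set A ->
  #|` fset_set [set x | A x /\ p x]| = (\sum_(x <- fset_set A) p x)%N.
Proof.
move=> finA; have -> : [set x | A x /\ p x] = A `&` [set x | p x] by [].
have -> : fset_set (A `&` [set x | p x]) = [fset x in fset_set A | p x]%fset.
  apply/fsetP => x; rewrite in_fset_set; last exact: finite_setIl.
  rewrite !inE /= in_fset_set //.
  by apply/idP/andP; rewrite !inE => -[].
rewrite -sum1_size big_fset /=.
by rewrite big_mkcond /=; apply: eq_bigr => x _; case: (p x).
Qed.

Lemma sum_nat_leq (n N : nat) : (n < N)%N -> (\sum_(1 <= r < N) (r <= n) = n)%N.
Proof.
move=> lt_nN; rewrite (big_cat_nat (n := n.+1)) //=.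
rewrite [X in (_ + X)%N](eq_big_nat _ _ (F2 := fun=> 0%N)) => [|r]; last first.
  by case/andP=> lt_nr _; rewrite leqNgt lt_nr.
rewrite big1_eq addn0 (eq_big_nat _ _ (F2 := fun=> 1%N)) => [|r].
  by rewrite sum_nat_const_nat subSS subn0 muln1.
by rewrite ltnS => /andP[_ ->].
Qed.

(** Lengths never exceed [m], so any cutoff above [m] captures every term; [N] stays free in order
    to match a partial sum of the series. *)
Lemma rr_A1E (m N : nat) : (m < N)%N ->
  rr_A1 m = (\sum_(1 <= r < N)
    if (r ^ 2 <= m)%N then num_partitions (m - r ^ 2) (m - r ^ 2) else 0)%N.
Proof.
move=> lt_mN; have finP := finite_partitions m.
set P := fset_set [set s | is_partition m s].
have lenN s : s \in P -> (rr_length s < N)%N.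
  by rewrite in_fset_set // inE => /rr_length_leq /leq_ltn_trans; apply.
have -> : rr_A1 m = (\sum_(0 <= l < N) l * rr_count l m)%N.
  rewrite /rr_A1 -(@fsbig_widen _ _ _ _ `I_N) //=; last first.
    move=> l [_ /= /negP]; rewrite -leqNgt => le_Nl.
    by rewrite rr_count_eq0 ?muln0 ?(leq_trans lt_mN).
  by rewrite -fsbig_ord big_mkord.
(* Each count becomes a sum of indicators over the partitions, so that each [s] contributes its own
   length. *)
transitivity (\sum_(s <- P) \sum_(0 <= l < N) l * (rr_length s == l))%N.
  rewrite exchange_big; apply: eq_bigr => l _; rewrite -big_distrr /=.
  rewrite -card_fset_set_sum //; congr (_ * #|` fset_set _|)%N.
  by apply/seteqP; split=> s [? /eqP].
(* The length of [s] is recounted as the number of [r >= 1] that do not exceed it. *)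
transitivity (\sum_(s <- P) \sum_(1 <= r < N) (r <= rr_length s))%N.
  rewrite big_seq [RHS]big_seq; apply: eq_bigr => s /lenN lt_sN.
  rewrite sum_nat_leq //.
  transitivity (\sum_(0 <= l < N | l == rr_length s) l)%N.
    rewrite [RHS]big_mkcond; apply: eq_bigr => l _.
    by rewrite eq_sym; case: eqP; rewrite ?muln1 ?muln0.
  by rewrite big_nat1_eq lt_sN.
rewrite exchange_big; apply: eq_bigr => r _; rewrite -card_rr_segment.
rewrite -card_fset_set_sum //; congr #|` fset_set _|.
by apply/seteqP; split=> s /=; rewrite leq_rr_length => /andP.
Qed.

(** * Limits of power series and the generating function of partitions *)

Lemma fps_cvg_le (R : Type) (u : nat -> fps R) (f : fps R) (n : nat) :
  fps_cvg u f -> exists N, forall k i, (N <= k)%N -> (i <= n)%N ->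
    fps_coef (u k) i = fps_coef f i.
Proof.
move=> uf; elim: n => [|n [N uN]].
  by have [N uN] := uf 0%N; exists N => k i le_Nk; rewrite leqn0 => /eqP->; exact: uN.
have [M uM] := uf n.+1; exists (maxn M N) => k i; rewrite geq_max => /andP[le_M le_N].
by rewrite leq_eqVlt => /predU1P[-> | ]; [exact: uM | exact: uN].
Qed.

(** The coefficient of degree [n] of a product involves only degrees at most [n], and [fps_cvg_le]
    makes all of these constant from a common rank on. *)
Lemma fps_cvgM (R : comNzRingType) (u v : nat -> fps R) (f g : fps R) :
  fps_cvg u f -> fps_cvg v g -> fps_cvg (fun k => u k * v k) (f * g).
Proof.
move=> uf vg n; have [M uM] := @fps_cvg_le _ _ _ n uf.
have [N vN] := @fps_cvg_le _ _ _ n vg; exists (maxn M N) => k.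
rewrite geq_max => /andP[le_M le_N] /=; apply: eq_bigr => i _.
by rewrite uM ?vN ?leq_subr // -ltnS.
Qed.

Lemma fps_cvg_cst (R : Type) (f : fps R) : fps_cvg (fun=> f) f.
Proof. by move=> n; exists 0%N. Qed.

Definition fps_partitions (R : comNzRingType) (k : nat) : fps R :=
  Fps (fun n => (num_partitions k n)%:R).

(** By [num_partitionsS], the factor [1 - q^(k+1)] lowers the bound from [k.+1] to [k]; at bound 0
    only the empty partition remains. *)
Lemma fps_partitions_prod (R : comNzRingType) (k : nat) :
  fps_partitions R k * \prod_(0 <= n < k) (1 - fps_q * fps_q ^+ n) = 1.
Proof.
elim: k => [|k IHk].
  rewrite big_geq // mulr1; apply: fpsP => n /=.
  by rewrite num_partitions0.
rewrite -[RHS]IHk big_nat_recr //= -exprS mulrCA mulrC; congr (_ * _).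
rewrite mulrBr mulr1; apply: fpsP => n.
rewrite -[LHS]/(fps_coef (fps_partitions R k.+1) n -
                fps_coef (fps_partitions R k.+1 * fps_q ^+ k.+1) n).
rewrite fps_coef_mulqexp /= num_partitionsS.
by case: ifP => _; rewrite natrD ?addrK // addr0 subr0.
Qed.

(** The constant sequence 1 is the termwise product of the truncated generating functions and the
    partial products, so the product of their two limits is 1. *)
Lemma inv_qpochhammer_qq (R : comUnitRingType) :
  (qpochhammer fps_q fps_q : fps R)^-1 =
  Fps (fun n => (num_partitions n n)%:R).
Proof.
apply: (mulIr (qpochhammer_unit R)); rewrite mulVr ?qpochhammer_unit //.
apply: (@fps_cvg_unique _ (fun=> 1)); first exact: fps_cvg_cst.
have -> : (fun=> 1 : fps R) = (fun k => fps_partitions R k *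
    \prod_(0 <= n < k) (1 - fps_q * fps_q ^+ n)).
  by apply/funext => k; rewrite fps_partitions_prod.
apply: fps_cvgM; last exact: qpochhammer_cvg.
by move=> n; exists n => k le_nk /=; rewrite num_partitions_stable.
Qed.

Lemma fps_coef_sum (R : comNzRingType) (I : Type) (s : seq I) (F : I -> fps R)
    (n : nat) :
  fps_coef (\sum_(i <- s) F i) n = \sum_(i <- s) fps_coef (F i) n.
Proof. by elim: s => [|i s IHs]; rewrite ?big_nil // !big_cons -IHs. Qed.

Lemma fps_coefMn (R : comNzRingType) (f : fps R) (k n : nat) :
  fps_coef (f *+ k) n = fps_coef f n *+ k.
Proof. by elim: k => // k IHk; rewrite !mulrS -IHk. Qed.

Theorem theorem3 :
  (qpochhammer fps_q fps_q : fps int)^-1 *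
      (fps_series 1 (fun r => fps_q ^+ (r ^ 2)%N) : fps int)
    = (fps_series 1
        (fun m => (\sum_(l \in [set: nat]) (l * rr_count l m)%N)%:R * fps_q ^+ m)
        : fps int)
  /\
  (fps_series 1
      (fun m => (\sum_(l \in [set: nat]) (l * rr_count l m)%N)%:R * fps_q ^+ m)
      : fps int)
    = fps_series 1 (fun m => (rr_A1 m)%:R * fps_q ^+ m).
Proof.
split=> //; rewrite inv_qpochhammer_qq.
set P := Fps _; set f := fps_series 1 _; set g := fps_series 1 _.
have f_cvg : fps_cvg (fun N => \sum_(1 <= r < N) fps_q ^+ (r ^ 2)%N) f.
  apply: fps_series_cvg => k n lt_nk; rewrite fps_coef_qexp.
  by case: eqP => // eq_n; nia.
have coef_term k n : fps_coef ((rr_A1 k)%:R * fps_q ^+ k : fps int) n =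
    if k == n then (rr_A1 n)%:R else 0.
  rewrite mulr_natl fps_coefMn fps_coef_qexp eq_sym.
  by case: eqP => [-> | _]; rewrite ?mul0rn.
have g_cvg : fps_cvg (fun N => \sum_(1 <= m < N) (rr_A1 m)%:R * fps_q ^+ m) g.
  apply: fps_series_cvg => k n lt_nk; rewrite coef_term.
  by case: eqP lt_nk => // ->; rewrite ltnn.
(* By uniqueness of limits, it is enough that the partial sums for [g] also converge to [P * f]. *)
apply: fps_cvg_unique g_cvg => m.
have [N PfN] := fps_cvgM _ _ _ _ _ (fps_cvg_cst _ P) f_cvg m.
(* From [N] on, degree [m] of [P] times the partial sum is stable; [m.+1] brings in the term of
   index [m] and allows [rr_A1E] with cutoff [k]. *)
exists (maxn N m.+1) => k; rewrite geq_max => /andP[le_Nk lt_mk].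
rewrite -(PfN k) // mulr_sumr !fps_coef_sum.
under eq_bigr => i _ do rewrite coef_term.
rewrite -big_mkcond big_nat1_eq lt_mk andbT.
transitivity ((rr_A1 m)%:R : int).
  (* The series starts at index 1, so degree 0 requires [rr_A1 0 = 0], an empty sum by [rr_A1E] with
     cutoff 1. *)
  by case: posnP => [-> | //]; rewrite (@rr_A1E 0 1) // big_geq.
rewrite (rr_A1E _ _ lt_mk) natr_sum; apply: eq_bigr => r _.
by rewrite fps_coef_mulqexp /=; case: ifP.
Qed.
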